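(* Let $a>0$, $b>0$, $n\ge 1$, and let $X_1,\dots,X_n\in\mathbb R$ be observations. Let $\Pi_{[-a,a]}(x):=\max\{-a,\min\{x,a\}\}$, $x\in\mathbb R$, denote the projection onto $[-a,a]$. Then every NPMLE $\widehat g_n$, i.e. every $\widehat g_n\in\mathcal P([-a,a])$ maximizing $\ell_n(g)=\sum_{i=1}^n\log m_g(X_i)$ over $g\in\mathcal P([-a,a])$, satisfies $$\mathrm{supp}(\widehat g_n)\subseteq\left\{\Pi_{[-a,a]}(X_1),\dots,\Pi_{[-a,a]}(X_n)\right\}.$$
   Context: $\mathcal P([-a,a])$ is the set of all Borel probability measures on $[-a,a]$. The Laplace density with scale $b$ is $f_b(z)=\frac{1}{2b}e^{-|z|/b}$, $z\in\mathbb R$. For $g\in\mathcal P([-a,a])$, $m_g(x):=\int_{[-a,a]}f_b(x-\theta)\,g(\mathrm d\theta)$, $x\in\mathbb R$. *)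

(* Defs.v *)
From HB Require Import structures.
From mathcomp Require Import all_boot all_order all_algebra.
From mathcomp Require Import all_classical all_reals all_analysis.

Set Implicit Arguments.
Unset Strict Implicit.
Unset Printing Implicit Defensive.
Import Order.TTheory GRing.Theory Num.Theory.
Import numFieldTopology.Exports numFieldNormedType.Exports.
Local Open Scope classical_set_scope.
Local Open Scope ring_scope.

Section LaplaceNPMLE.
Variable R : realType.

(* A Borel probability measure on [-a, a] is encoded as a Borel probability
   measure on the whole line that gives mass 1 to [-a, a]. *)
Definition prob_on (a : R) : set (probability (measurableTypeR R) R) :=
  [set g : probability (measurableTypeR R) R | g `[- a, a]%classic = 1%E].

Definition laplace_pdf (b z : R) : R := (2 * b)^-1 * expR (- `|z| / b).

(* For 0 < b the integrand is bounded and continuous, hence integrable, so the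
   real-valued integral [Rintegral] loses nothing here. *)
Definition mixture_pdf (a b : R) (g : probability (measurableTypeR R) R)
    (x : R) : R :=
  \int[g]_(theta in `[- a, a]) laplace_pdf b (x - theta).

Definition log_likelihood (a b : R) (n : nat) (X : 'I_n -> R)
    (g : probability (measurableTypeR R) R) : R :=
  \sum_(i < n) ln (mixture_pdf a b g (X i)).

Definition is_NPMLE (a b : R) (n : nat) (X : 'I_n -> R)
    (g : probability (measurableTypeR R) R) : Prop :=
  prob_on a g /\
  (forall h : probability (measurableTypeR R) R,
     prob_on a h -> log_likelihood a b X h <= log_likelihood a b X g).

(* Since [-a, a] is closed, for g in [prob_on a] this is also the support of g
   computed with relatively open subsets of [-a, a]. *)
Definition measure_support (g : probability (measurableTypeR R) R) : set R :=
  [set x | forall U : set R, open U -> U x -> (0 < g U)%E].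

Definition proj_itv (a x : R) : R := Num.max (- a) (Num.min x a).

End LaplaceNPMLE.

(* Main.v *)
Require Import Defs.
From HB Require Import structures.
From mathcomp Require Import all_boot all_order all_algebra.
From mathcomp Require Import all_classical all_reals all_analysis.
From mathcomp Require Import measurable_realfun ring lra.
Import Order.TTheory GRing.Theory Num.Theory.
Import numFieldTopology.Exports numFieldNormedType.Exports.
Local Open Scope classical_set_scope.
Local Open Scope ring_scope.

(** If a point [x] of the support of [g] were none of the projected observations,
    [g] could be modified near [x] so that the mixture density strictly increases
    at every observation, which contradicts maximality of the likelihood.  The
    modification sweeps the mass of a small interval [c, d] around [x] to one
    or both of its endpoints.

    If [x] lies strictly between [-a] and [a], then no observation equals [x],
    and [c, d] can be taken inside [-a, a] with no observation in its interior.
    Each point mass at [t] in [c, d] is spread over [c] and [d] keeping its mean.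
    Seen from an observation outside ]c, d[, the Laplace kernel is the exponential
    of a nonconstant affine function of [t] on [c, d], hence strictly convex, so
    the spreading can only raise its average, and raises it strictly on ]c, d[
    ([laplace_pdf_lt_chord]).  Since [x] is in the support, ]c, d[ has positive
    mass, and the increase is strict at every observation at once.

    If [x] is [-a] or [a], every observation lies strictly on the inner side of
    [x], so moving the mass near [x] inwards, to a point that is not past any
    observation, brings it closer to each of them ([retract_not_NPMLE]).

    Both modifications are instances of one construction ([exists_sweep],
    [sweep_not_NPMLE]). *)

(** * Integration against a probability measure *)

Lemma Rintegral_gt0 {d} {T : measurableType d} {R : realType}
    (mu : {measure set T -> \bar R}) {D V : set T} {f : T -> R} :
  measurable D -> measurable V -> V `<=` D ->
  mu.-integrable D (EFin \o f) ->
  (forall x, D x -> 0 <= f x) -> (forall x, V x -> 0 < f x) ->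
  (0 < mu V)%E -> 0 < \int[mu]_(x in D) f x.
Proof.
move=> mD mV VD intf f0 fV muV.
rewrite lt_neqAle Rintegral_ge0// andbT eq_sym.
apply: contraTneq muV => int0; rewrite -leNgt.
have /integrableP[mf _] := intf.
have : (\int[mu]_(x in D) `|(f x)%:E| = 0)%E.
  under eq_integral => x /set_mem Dx do rewrite gee0_abs ?lee_fin ?f0//.
  rewrite -[LHS]fineK ?(integrable_fin_num _ intf)//.
  by rewrite -[fine _]/(Rintegral _ _ _) int0.
move=> /(ae_eq_integral_abs mu mD mf)[N [mN N0 subN]].
rewrite -N0 le_measure ?inE// => x Vx; apply: subN => /= /(_ (VD _ Vx))[fx0].
by move: (fV _ Vx); rewrite fx0 ltxx.
Qed.

Lemma integrable_ge0_le {d} {T : measurableType d} {R : realType}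
    (P : probability T R) {D : set T} (M : R) {f : T -> R} :
  measurable D -> measurable_fun D f -> (forall x, D x -> 0 <= f x <= M) ->
  P.-integrable D (EFin \o f).
Proof.
move=> mD mf f0M; apply: measurable_bounded_integrable => //.
  by rewrite (le_lt_trans (probability_le1 P mD))// ltry.
exists M; split=> [|N MN x /= /f0M/andP[f0 fM]]; first exact: num_real.
by rewrite ger0_norm// (le_trans fM)// ltW.
Qed.

(** Restricting the measure and restricting the domain give the same integral,
    because the part of the domain outside [E] is null for the restricted
    measure. *)
Lemma integral_mrestr {d} {T : measurableType d} {R : realType}
    (mu : {measure set T -> \bar R}) {D E : set T} (mE : measurable E)
    (f : T -> \bar R) :
  measurable D -> measurable_fun D f -> (forall x, D x -> 0 <= f x)%E ->
  (\int[mrestr mu mE]_(x in D) f x = \int[mu]_(x in D `&` E) f x)%E.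
Proof.
move=> mD mf f0.
have N0 : mrestr mu mE (~` E) = 0%E by rewrite /mrestr setICl measure0.
rewrite (ge0_negligible_integral (measurableC mE) mD mf f0 N0).
rewrite setDE setCK; apply: eq_measure_integral => A mA AE.
by rewrite /= /mrestr setIidl// => x /AE[].
Qed.

(** * Sweeping mass to two points *)

(** The adjoint, on test functions, of the operation on measures that sends a
    point mass at [x] in [I] to mass [1 - w x] at [c] and [w x] at [d]. *)
Definition sweep_fun {T : Type} {R : realType} (I : set T) (w : T -> R)
    (c d : T) (k : T -> R) (x : T) : R :=
  if x \in I then (1 - w x) * k c + w x * k d else k x.

Section sweep.
Context {disp} {T : measurableType disp} {R : realType} (P : probability T R).
Context {I : set T} {w : T -> R} (c d : T).
Hypotheses (mI : measurable I) (mw : measurable_fun I w).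
Hypothesis w01 : forall x, I x -> 0 <= w x <= 1.

Lemma measurable_sweep_fun {D : set T} {k : T -> R} : measurable D -> I `<=` D ->
  measurable_fun D k -> measurable_fun D (sweep_fun I w c d k).
Proof.
move=> mD ID mk.
have -> : D = I `|` (D `\` I) by rewrite setDUK.
apply/measurable_funU => //; first exact: measurableD.
split.
- apply: (eq_measurable_fun (fun x => (1 - w x) * k c + w x * k d)).
    by move=> x xI; rewrite /sweep_fun xI.
  apply: measurable_funD; apply: measurable_funM => //.
  by apply: measurable_funB.
- apply: (eq_measurable_fun k); last by apply: measurable_funS mk => //; exact: subDsetl.
  by move=> x /set_mem[_ nI]; rewrite /sweep_fun memNset.
Qed.

(** The swept measure is the restriction of [P] to the complement of [I] plus two
    atoms, at [c] and [d], that carry the averages of [1 - w] and [w] over [I].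
    Its total mass is 1 because [sweep_fun] fixes the constant function 1. *)
Lemma exists_sweep :
  exists Q : probability T R,
  forall (D : set T) (k : T -> R), measurable D -> I `<=` D -> D c -> D d ->
    measurable_fun D k -> (forall x, D x -> 0 <= k x) ->
    \int[Q]_(x in D) k x = \int[P]_(x in D) sweep_fun I w c d k x.
Proof.
have w0 x : I x -> 0 <= w x by move=> /w01/andP[].
have w1 x : I x -> 0 <= 1 - w x by move=> /w01/andP[_]; rewrite subr_ge0.
have mw1 : measurable_fun I (fun x => 1 - w x) by exact: measurable_funB.
pose A := NngNum (@Rintegral_ge0 _ _ _ P _ _ w1).
pose B := NngNum (@Rintegral_ge0 _ _ _ P _ _ w0).
have AE : (A%:num%:E = \int[P]_(x in I) (1 - w x)%:E)%E.
  rewrite /A /= /Rintegral fineK//; apply: integrable_fin_num => //.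
  apply: (integrable_ge0_le P 1) => // x Ix.
  by rewrite w1//= lerBlDr lerDl w0.
have BE : (B%:num%:E = \int[P]_(x in I) (w x)%:E)%E.
  rewrite /B /= /Rintegral fineK//; apply: integrable_fin_num => //.
  exact: (integrable_ge0_le P 1).
pose mu : {measure set T -> \bar R} :=
  measure_add (measure_add (mrestr P (measurableC mI)) (mscale A \d_c))
              (mscale B \d_d).
have muE (D : set T) (k : T -> R) : measurable D -> I `<=` D -> D c -> D d ->
    measurable_fun D k -> (forall x, D x -> 0 <= k x) ->
    (\int[mu]_(x in D) (k x)%:E = \int[P]_(x in D) (sweep_fun I w c d k x)%:E)%E.
  move=> mD ID Dc Dd mk k0.
  have mEk : measurable_fun D (EFin \o k : T -> \bar R) by exact/measurable_EFinP.
  have k0E x : D x -> (0 <= (EFin \o k) x)%E by move=> Dx; rewrite lee_fin k0.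
  have := k0 _ Dc; have := k0 _ Dd => kd0 kc0.
  rewrite /mu 2?ge0_integral_measure_add// 2?ge0_integral_mscale// 2?integral_dirac//.
  rewrite !diracE !mem_set// !mul1e AE BE integral_mrestr//.
  rewrite -setDE -{2}(setDUK ID) setUC ge0_integral_setU//=; last first.
  - by apply/disj_setPS => x [[]].
  - move=> x xD; have {xD}Dx : D x by case: xD => [[]|/ID].
    rewrite lee_fin /sweep_fun.
    case: ifPn => [/set_mem Ix|_]; last exact: k0.
    by rewrite addr_ge0// mulr_ge0// ?w0 ?w1.
  - by rewrite setUC setDUK//; apply/measurable_EFinP; exact: measurable_sweep_fun.
  - exact: measurableD.
  rewrite -addeA; congr (_ + _)%E.
    apply: eq_integral => x /set_mem[_ nI].
    by rewrite /sweep_fun memNset.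
  rewrite -!ge0_integralZr//=; try exact/measurable_EFinP.
  rewrite -ge0_integralD//=.
  - by apply: eq_integral => x xI; rewrite /sweep_fun xI -!EFinM -EFinD.
  - by move=> x Ix; rewrite mule_ge0// lee_fin w1.
  - by apply: emeasurable_funM => //; exact/measurable_EFinP.
  - by move=> x Ix; rewrite mule_ge0// lee_fin w0.
  - by apply: emeasurable_funM => //; exact/measurable_EFinP.
have mu1 : mu setT = 1%E.
  rewrite -[LHS]mul1e -integral_cst//= (muE setT (cst 1))//.
  rewrite (eq_integral (cst 1%E)) ?integral_cst//.
    by rewrite mul1e; exact: probability_setT.
  by move=> x _; rewrite /sweep_fun/=; case: ifP => //; rewrite !mulr1 subrK.
(* The total mass being 1, normalization only serves to turn [mu] into an element
   of type [probability]. *)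
exists (mnormalize mu P) => D k mD ID Dc Dd mk k0.
rewrite /Rintegral -muE//; congr fine; apply: eq_measure_integral => A' _ _.
by rewrite /= /mnormalize mu1 onee_eq0/= invr1 mule1.
Qed.

End sweep.

(** * Strict convexity of the Laplace kernel away from its centre *)

(** The graph of the exponential lies strictly above its tangent at
    [m = (1 - l) u + l v], except at [m]; averaging the tangent bounds at [u] and
    [v] with weights [1 - l] and [l] leaves the value at [m]. *)
Lemma expR_strict_convex {R : realType} (l u v : R) : 0 < l < 1 -> u != v ->
  expR ((1 - l) * u + l * v) < (1 - l) * expR u + l * expR v.
Proof.
move=> /andP[l0 l1] uv; set m := (1 - l) * u + l * v.
have tangent z : z != m -> expR m * (1 + (z - m)) < expR z.
  move=> zm; rewrite -[in ltRHS](subrKC m z) (expRD m) ltr_pM2l ?expR_gt0//.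
  by rewrite expR_gt1Dx// subr_eq0.
have um : u != m.
  rewrite -subr_eq0 (_ : u - m = l * (u - v)); last by rewrite /m; ring.
  by apply: mulf_neq0; rewrite ?subr_eq0// gt_eqF.
have vm : v != m.
  rewrite -subr_eq0 (_ : v - m = (1 - l) * (v - u)); last by rewrite /m; ring.
  by apply: mulf_neq0; rewrite subr_eq0 1?eq_sym// lt_eqF.
have -> : expR m =
    (1 - l) * (expR m * (1 + (u - m))) + l * (expR m * (1 + (v - m))).
  by rewrite /m; ring.
by apply: ltrD; rewrite ltr_pM2l ?tangent// subr_gt0.
Qed.

Section laplace.
Context {R : realType} {b : R} (b_gt0 : 0 < b).

Lemma laplace_pdf_gt0 z : 0 < laplace_pdf b z.
Proof. by rewrite mulr_gt0 ?expR_gt0// invr_gt0 mulr_gt0. Qed.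

Lemma lt_laplace_pdf y z : `|y| < `|z| -> laplace_pdf b z < laplace_pdf b y.
Proof.
move=> yz; rewrite /laplace_pdf ltr_pM2l ?invr_gt0 ?mulr_gt0//.
by rewrite ltr_expR ltr_pM2r ?invr_gt0// ltrN2.
Qed.

Lemma laplace_pdf_le z : laplace_pdf b z <= (2 * b)^-1.
Proof.
rewrite /laplace_pdf ger_pMr ?invr_gt0 ?mulr_gt0// -expR0 ler_expR.
by rewrite mulNr oppr_le0 divr_ge0// ltW.
Qed.

Lemma measurable_laplace_pdf_sub (x : R) (D : set R) :
  measurable_fun D (fun t => laplace_pdf b (x - t)).
Proof.
apply: measurable_funTS; apply: measurable_funM => //.
apply: measurableT_comp => //; apply: measurable_funM => //.
by do 2 apply: measurableT_comp => //; apply: measurable_funB.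
Qed.

(** The kink of the kernel is at [x], outside ]c, d[, so the exponent is affine on
    [c, d]; it is not constant there, so convexity is strict. *)
Lemma laplace_pdf_lt_chord (c d t x : R) : c < t < d -> x <= c \/ d <= x ->
  laplace_pdf b (x - t) <
  (1 - (t - c) / (d - c)) * laplace_pdf b (x - c)
  + (t - c) / (d - c) * laplace_pdf b (x - d).
Proof.
move=> /andP[ct td] xcd; set l := (t - c) / (d - c).
have cd : 0 < d - c by rewrite subr_gt0 (lt_trans ct).
have l01 : 0 < l < 1.
  have tc : 0 < t - c by rewrite subr_gt0.
  by rewrite /l divr_gt0//= ltr_pdivrMr// mul1r ltrD2r.
have tE : t = (1 - l) * c + l * d.
  have : l * (d - c) = t - c by rewrite /l divfK// gt_eqF.
  by move=> h; rewrite (_ : t = (t - c) + c); [rewrite -h; ring|ring].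
have neq : - `|x - c| / b != - `|x - d| / b.
  apply/negP => /eqP/(mulIf (invr_neq0 (lt0r_neq0 b_gt0)))/oppr_inj.
  by case: xcd => h; [rewrite !ler0_norm|rewrite !ger0_norm]; lra.
have nE : `|x - t| = (1 - l) * `|x - c| + l * `|x - d|.
  by case: xcd => h; [rewrite !ler0_norm|rewrite !ger0_norm];
    rewrite ?{1}tE; first [ring|lra].
rewrite /laplace_pdf !(mulrCA _ (2 * b)^-1) -mulrDr ltr_pM2l ?invr_gt0 ?mulr_gt0//.
rewrite (_ : - `|x - t| / b =
             (1 - l) * (- `|x - c| / b) + l * (- `|x - d| / b)).
  exact: expR_strict_convex.
by rewrite nE; ring.
Qed.

End laplace.

(** * Improving the likelihood *)

Section mixture.
Context {R : realType} {a b : R} (b_gt0 : 0 < b).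
Implicit Type g : probability (measurableTypeR R) R.

Lemma integrable_laplace_pdf_sub g (x : R) :
  g.-integrable `[- a, a] (EFin \o (fun t => laplace_pdf b (x - t))).
Proof.
apply: (integrable_ge0_le g (2 * b)^-1) => //; first exact: measurable_laplace_pdf_sub.
by move=> t _; rewrite ltW ?laplace_pdf_gt0//= laplace_pdf_le.
Qed.

(** Positivity matters because [ln] is strictly increasing only on positive
    numbers. *)
Lemma mixture_pdf_gt0 g (x : R) : prob_on a g -> 0 < mixture_pdf a b g x.
Proof.
move=> ga; rewrite /mixture_pdf.
apply: (Rintegral_gt0 g (D := `[- a, a]) (V := `[- a, a])) => //.
- exact: integrable_laplace_pdf_sub.
- by move=> t _; rewrite ltW ?laplace_pdf_gt0.
- by move=> t _; rewrite laplace_pdf_gt0.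
- by rewrite [ltRHS]ga.
Qed.

Lemma lt_log_likelihood {n} (X : 'I_n -> R) g h : (0 < n)%N ->
  prob_on a g -> prob_on a h ->
  (forall i, mixture_pdf a b g (X i) < mixture_pdf a b h (X i)) ->
  log_likelihood a b X g < log_likelihood a b X h.
Proof.
move=> n0 ga ha gh; apply: ltr_sum.
  by apply/hasP; exists (Ordinal n0) => //; rewrite mem_index_enum.
by move=> i _; rewrite ltr_ln ?posrE ?mixture_pdf_gt0.
Qed.

(** The mixture density of the swept measure at [X i] is the [g]-integral of the
    swept kernel, so it exceeds that of [g] by the integral of a gap that is
    nonnegative and is positive on [V]. *)
Lemma sweep_not_NPMLE {n} (X : 'I_n -> R) g {I V : set (measurableTypeR R)}
    {w : measurableTypeR R -> R} {c d : R} :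
  (0 < n)%N -> measurable I -> I `<=` `[- a, a] -> measurable_fun I w ->
  (forall t, I t -> 0 <= w t <= 1) -> `[- a, a]%classic c -> `[- a, a]%classic d ->
  measurable V -> V `<=` I -> (0 < g V)%E ->
  (forall i t, I t -> laplace_pdf b (X i - t) <=
     (1 - w t) * laplace_pdf b (X i - c) + w t * laplace_pdf b (X i - d)) ->
  (forall i t, V t -> laplace_pdf b (X i - t) <
     (1 - w t) * laplace_pdf b (X i - c) + w t * laplace_pdf b (X i - d)) ->
  ~ is_NPMLE a b X g.
Proof.
move=> n0 mI Ia mw w01 ca da mV VI gV0 leI ltV [ga gmax].
have [h hE] := @exists_sweep _ _ _ g _ _ c d mI mw w01.
have mD : measurable (`[- a, a] : set (measurableTypeR R)) by [].
have ha : prob_on a h.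
  have := hE `[- a, a]%classic (cst 1) mD Ia ca da (measurable_cst _) (fun _ _ => ler01).
  rewrite (@eq_Rintegral _ _ _ g _ (cst 1)); last first.
    by move=> t _; rewrite /sweep_fun/=; case: ifP => //; rewrite !mulr1 subrK.
  rewrite !Rintegral_cst// !mul1r => hD.
  have hfin : h `[- a, a]%classic \is a fin_num by exact: fin_num_measure.
  exact: etrans (esym (fineK hfin)) (congr1 EFin (etrans hD (congr1 fine ga))).
have := gmax _ ha; apply/negP; rewrite -ltNge.
apply: lt_log_likelihood => // i.
pose k (t : measurableTypeR R) := laplace_pdf b (X i - t).
have mk : measurable_fun (`[- a, a] : set (measurableTypeR R)) k.
  exact: measurable_laplace_pdf_sub.
have k0 t : 0 <= k t by rewrite ltW ?laplace_pdf_gt0.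
have ksI t : `[- a, a]%classic t -> k t <= sweep_fun I w c d k t.
  move=> ta; rewrite /sweep_fun.
  by case: ifPn => [/set_mem It|_]; [exact: leI|exact: lexx].
have ik : g.-integrable `[- a, a] (EFin \o k) by exact: integrable_laplace_pdf_sub.
have isk : g.-integrable `[- a, a] (EFin \o sweep_fun I w c d k).
  apply: (integrable_ge0_le g (2 * b)^-1) => //.
    exact: (measurable_sweep_fun c d mI mw mD Ia mk).
  move=> t ta; rewrite (le_trans (k0 t)) ?ksI//= /sweep_fun.
  case: ifPn => [/set_mem/w01/andP[w0 w1]|_]; last exact: laplace_pdf_le.
  rewrite (_ : (2 * b)^-1 = (1 - w t) * (2 * b)^-1 + w t * (2 * b)^-1);
    last by ring.
  by rewrite lerD// ler_wpM2l ?subr_ge0// laplace_pdf_le.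
rewrite /mixture_pdf -/k (hE _ k mD)// -subr_gt0 -RintegralB//.
apply: (Rintegral_gt0 g (V := V)) => //.
- by move=> t /VI/Ia.
- exact: (integrableB mD isk ik).
- by move=> t ta; rewrite subr_ge0 ksI.
- by move=> t Vt; rewrite subr_gt0 /sweep_fun mem_set; [exact: ltV|exact: VI].
Qed.

End mixture.

(** Moving all the mass of [I] to one point [p] is the sweep with [c = d = p], and
    the Laplace density decreases with the distance to its centre. *)
Lemma retract_not_NPMLE {R : realType} {a b : R} {n} (X : 'I_n -> R)
    (g : probability (measurableTypeR R) R) {I V : set (measurableTypeR R)} {p : R} :
  0 < b -> (0 < n)%N -> measurable I -> I `<=` `[- a, a] -> `[- a, a]%classic p ->
  measurable V -> V `<=` I -> (0 < g V)%E ->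
  (forall i t, I t -> `|X i - p| <= `|X i - t|) ->
  (forall i t, V t -> `|X i - p| < `|X i - t|) ->
  ~ is_NPMLE a b X g.
Proof.
move=> b0 n0 mI Ia pa mV VI gV leI ltV.
apply: (sweep_not_NPMLE b0 X g (w := cst 0) n0 mI Ia _ _ pa pa mV VI gV) => //.
- by move=> t _ /=; rewrite lexx ler01.
- move=> i t It; rewrite /= subr0 mul1r mul0r addr0.
  have := leI i t It; rewrite le_eqVlt => /predU1P[tp|];
    last by move/(lt_laplace_pdf b0)/ltW.
  by rewrite /laplace_pdf tp.
- by move=> i t Vt; rewrite /= subr0 mul1r mul0r addr0 lt_laplace_pdf// ltV.
Qed.

(** With [U] the complement of [-a, a], this also shows that the support of [g] is
    contained in [-a, a]. *)
Lemma measure_support_setI {R : realType} {a : R}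
    {g : probability (measurableTypeR R) R} {x : R} {U : set R} :
  prob_on a g -> measure_support g x -> open U -> U x ->
  (0 < g (U `&` `[(- a)%R, a]%classic))%E.
Proof.
move=> ga gx oU Ux; rewrite lt0e measure_ge0 andbT.
apply: contraTneq (gx _ oU Ux) => UD0; rewrite -leNgt.
have mD : measurable (`[- a, a] : set (measurableTypeR R)) by [].
have mU : measurable (U : set (measurableTypeR R)) by exact: open_measurable.
have gC0 : g (~` `[- a, a]%classic) = 0%E.
  by rewrite (probability_setC g mD) [X in (1 - X)%E]ga subee.
have mC : measurable (~` `[- a, a]%classic : set (measurableTypeR R)).
  exact: measurableC.
rewrite -(setIT U) -(setUv `[- a, a]%classic) setIUr.
apply: le_trans (measureU2 g (measurableI _ _ mU mD) (measurableI _ _ mU mC)) _.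
rewrite [X in (X + _)%E]UD0 add0e -gC0.
by apply: le_measure; rewrite ?inE; [exact: measurableI|exact: mC|exact: subIsetr].
Qed.

Lemma exists_pos_lower_bound {R : realType} {n} (m : R) (F : 'I_n -> R) :
  0 < m -> (forall i, 0 < F i) -> exists e, [/\ 0 < e, e <= m & forall i, e <= F i].
Proof.
move=> m0 F0; exists (\big[Num.min/m]_i F i); split.
- by apply: lt_bigmin.
- exact: bigmin_le_id.
- by move=> i; exact: bigmin_le.
Qed.

(** * Support of a maximizer *)

Theorem theorem3p2 (R : realType) (a b : R) (n : nat) (X : 'I_n -> R)
    (a_gt0 : 0 < a) (b_gt0 : 0 < b) (n_gt0 : (1 <= n)%N)
    (g : probability (measurableTypeR R) R) :
  is_NPMLE a b X g ->
  measure_support g `<=` [set proj_itv a (X i) | i in [set: 'I_n]].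
Proof.
move=> gN x gx; apply: contrapT => xX.
have ga := gN.1.
have projX i : proj_itv a (X i) != x.
  by apply/eqP => pxi; apply: xX; exists i.
have xa : x \in `[- a, a].
  apply/negPn/negP => xa.
  have oD : open (~` `[- a, a]%classic : set R).
    by apply: closed_openC; exact: itv_closed.
  have := measure_support_setI ga gx oD (negP xa).
  by rewrite setICl measure0 ltxx.
move: (xa); rewrite in_itv/= => /andP[ax xa'].
pose nbhd e : set (measurableTypeR R) := `](x - e), (x + e)[ `&` `[- a, a].
have mnbhd e : measurable (nbhd e) by exact: measurableI.
have gnbhd e : 0 < e -> (0 < g (nbhd e))%E.
  move=> e0.
  have oU : open (`](x - e), (x + e)[%classic : set R) by exact: itv_open.
  by apply: (measure_support_setI ga gx oU); rewrite /= in_itv/=; lra.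
have [xNa|xNa] := eqVneq x (- a).
  (* [e <= 2 a] keeps the target point [x + e] inside [-a, a]. *)
  have [|i|e [e0 ea eX]] := @exists_pos_lower_bound _ _ (2 * a) (fun i => X i - x).
  - by lra.
  - rewrite subr_gt0 ltNge; apply/negP => Xx; case/eqP: (projX i).
    by rewrite /proj_itv min_l ?max_l//; lra.
  apply: (retract_not_NPMLE X g (I := `[x, x + e]%classic) (p := x + e)
            b_gt0 n_gt0 _ _ _ (mnbhd e) _ (gnbhd e e0) _ _ gN) => //.
  - by move=> t; rewrite /= !in_itv/=; lra.
  - by rewrite /= !in_itv/=; lra.
  - by move=> t; rewrite /nbhd /= !in_itv/=; lra.
  - move=> i t; rewrite /= in_itv/=; have := eX i => ? ?.
    by rewrite !ger0_norm; lra.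
  - move=> i t; rewrite /nbhd /= !in_itv/=; have := eX i => ? ?.
    by rewrite !ger0_norm; lra.
have [xEa|xEa] := eqVneq x a.
  have [|i|e [e0 ea eX]] := @exists_pos_lower_bound _ _ (2 * a) (fun i => x - X i).
  - by lra.
  - rewrite subr_gt0 ltNge; apply/negP => Xx; case/eqP: (projX i).
    by rewrite /proj_itv min_r ?max_r//; lra.
  apply: (retract_not_NPMLE X g (I := `[x - e, x]%classic) (p := x - e)
            b_gt0 n_gt0 _ _ _ (mnbhd e) _ (gnbhd e e0) _ _ gN) => //.
  - by move=> t; rewrite /= !in_itv/=; lra.
  - by rewrite /= !in_itv/=; lra.
  - by move=> t; rewrite /nbhd /= !in_itv/=; lra.
  - move=> i t; rewrite /= in_itv/=; have := eX i => ? ?.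
    by rewrite !ler0_norm; lra.
  - move=> i t; rewrite /nbhd /= !in_itv/=; have := eX i => ? ?.
    by rewrite !ler0_norm; lra.
have {}ax : - a < x by rewrite lt_neqAle eq_sym xNa.
have {}xa' : x < a by rewrite lt_neqAle xEa.
have [|i|e [e0 ea eX]] := @exists_pos_lower_bound _ _ (Num.min (x + a) (a - x))
    (fun i => `|X i - x|).
- by rewrite lt_min; apply/andP; split; lra.
- rewrite normr_gt0 subr_eq0; apply: contra_neq (projX i) => ->.
  by rewrite /proj_itv min_l ?max_r// ltW.
move: ea; rewrite le_min => /andP[eax exa].
have Xout i : X i <= x - e \/ x + e <= X i.
  have := eX i; rewrite ler_normr => /orP[h|h]; [right|left]; lra.
pose c := x - e; pose d := x + e.
have cd : 0 < d - c by rewrite /c /d; lra.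
(* The weights for which the two masses at [c] and [d] have mean [t]. *)
pose w (t : measurableTypeR R) : R := (t - c) / (d - c).
have nbhdI t : nbhd e t -> c < t < d by move=> []; rewrite /= in_itv.
apply: (sweep_not_NPMLE b_gt0 X g (I := `[c, d]%classic) (w := w)
          (c := c) (d := d) n_gt0 _ _ _ _ _ _ (mnbhd e) _ (gnbhd e e0) _ _ gN) => //.
- by move=> t; rewrite /c /d /= !in_itv/=; lra.
- by apply: measurable_funM => //; exact: measurable_funB.
- move=> t; rewrite /= in_itv/= /w => /andP[ct td].
  have tc : 0 <= t - c by rewrite subr_ge0.
  rewrite (divr_ge0 tc (ltW cd))/=.
  by rewrite ler_pdivrMr// mul1r lerD2r.
- by rewrite /c /= !in_itv/=; lra.
- by rewrite /d /= !in_itv/=; lra.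
- by move=> t /nbhdI/andP[? ?]; rewrite /= in_itv/= !ltW.
- move=> i t; rewrite /= in_itv/= => /andP[]; rewrite (le_eqVlt c) (le_eqVlt t).
  move=> /predU1P[<- _|ct /predU1P[->|td]].
  + by rewrite /w subrr mul0r subr0 mul1r mul0r addr0 lexx.
  + by rewrite /w divff ?(gt_eqF cd)// subrr mul0r add0r mul1r lexx.
  + by apply/ltW/laplace_pdf_lt_chord; [|rewrite ct|exact: Xout].
- by move=> i t /nbhdI ctd; apply: laplace_pdf_lt_chord => //; exact: Xout.
Qed.
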